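(* Let $\delta\in\{\mathsf{none},\mathsf{down},\mathsf{up},\mathsf{updown}\}^n$. The map $f:\mathcal{PT}_n(\delta)\to\mathcal{C}_\delta$, $f(T)=\vec{c}(T)$, sending a $\delta$-permutree to its cubic vector is injective.
   Context: A permutree on $n$ vertices is a directed (unrooted, planar) tree $T$ with vertex set $\{v_1,\dots,v_n\}$, edges oriented from child to parent, such that each vertex $v_i$ has exactly one or two parents and exactly one or two children, and: if $v_i$ has two parents then every vertex $v_j$ in its left ancestor subtree has $j<i$ and every $v_k$ in its right ancestor subtree has $k>i$; if $v_i$ has two children then every $v_j$ in its left descendant subtree $LD_i$ has $j<i$ and every $v_k$ in its right descendant subtree $RD_i$ has $k>i$ (ancestor/descendant subtrees are the components of $T\setminus v_i$ containing the respective parents/children; if $v_i$ has one child, $D_i$ denotes its unique descendant subtree). The decoration $\delta(T)_i$ is $\mathsf{none}$, $\mathsf{down}$, $\mathsf{up}$, $\mathsf{updown}$ according as $v_i$ has (one parent, one child), (one parent, two children), (two parents, one child), (two parents, two children); $\mathcal{PT}_n(\delta)$ is the set of permutrees with decoration $\delta$ (convention $\delta_1=\delta_n=\mathsf{none}$). The cubic set of $T$ is $C(T)=\{(i,j): i<j,\ v_j\in D_i\text{ if }\delta_i\in\{\mathsf{none},\mathsf{up}\};\ v_j\in RD_i\text{ if }\delta_i\in\{\mathsf{down},\mathsf{updown}\}\}$, with components $C(T)_i=\{j:(i,j)\in C(T)\}$, and the cubic vector is $\vec{c}(T)=(c_1,\dots,c_{n-1})$ with $c_i=|C(T)_i|$.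 $\mathcal{C}_\delta$ is the convex hull of all cubic vectors of $\delta$-permutrees. *)

(* Defs.v *)
From HB Require Import structures.
From mathcomp Require Import all_boot all_order all_algebra.
From mathcomp Require Import boolp classical_sets reals convex.

Set Implicit Arguments.
Unset Strict Implicit.
Unset Printing Implicit Defensive.

Import Order.TTheory GRing.Theory Num.Theory.

Inductive decoration := dec_none | dec_down | dec_up | dec_updown.

Definition bools_of_decoration (d : decoration) : bool * bool :=
  match d with
  | dec_none => (false, false)
  | dec_down => (false, true)
  | dec_up => (true, false)
  | dec_updown => (true, true)
  end.

Definition decoration_of_bools (b : bool * bool) : decoration :=
  match b with
  | (false, false) => dec_none
  | (false, true) => dec_down
  | (true, false) => dec_up
  | (true, true) => dec_updown
  end.

Lemma bools_of_decorationK : cancel bools_of_decoration decoration_of_bools.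
Proof. by case. Qed.

HB.instance Definition _ :=
  Equality.copy decoration (can_type bools_of_decorationK).

(* The bound on the length of the cycle loses nothing: the vertices of a      *)
(* simple cycle are distinct, so there are at most #|V| of them.              *)
Definition acyclic (V : finType) (e : rel V) : bool :=
  [forall k : 'I_#|V|.+1, forall s : k.-tuple V, (2 < k) ==> ~~ ucycleb e s].

Definition is_tree (V : finType) (e : rel V) : bool :=
  [&& [forall x, ~~ e x x], [forall x, forall y, e x y == e y x],
      [forall x, forall y, connect e x y] & acyclic e].

(* Vertices v_1, ..., v_n are the elements of 'I_n (v_i is i - 1).  A         *)
(* permutree has, besides its n vertices, unlabelled leaves: a parent or a    *)
(* child of a vertex may be a leaf, and the corresponding subtree then        *)
(* contains no vertex.  The planar structure is given by listing, for each    *)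
(* vertex, its parents and its children from left to right, with [Some j] for *)
(* the vertex j and [None] for a leaf.                                        *)
Definition slots (n : nat) : Type := {ffun 'I_n -> seq (option 'I_n)}.

Definition adjacent n (par chi : slots n) : rel 'I_n :=
  fun i j => (Some j \in par i) || (Some j \in chi i).

(* Vertices of the component of T \ v_i that contains the neighbour o of v_i. *)
Definition component n (e : rel 'I_n) (i : 'I_n) (o : option 'I_n) :
    {set 'I_n} :=
  if o is Some x
  then [set j | connect (fun a b => [&& e a b, a != i & b != i]) x j]
  else finset.set0.

Definition left_neighbour n (s : slots n) (i : 'I_n) := nth None (s i) 0.
Definition right_neighbour n (s : slots n) (i : 'I_n) := nth None (s i) 1.

(* [s] is one of [par], [chi].                                                *)
Definition split_condition n (e : rel 'I_n) (s : slots n) : bool :=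
  [forall i, (size (s i) == 2) ==>
    [forall j in component e i (left_neighbour s i), j < i] &&
    [forall k in component e i (right_neighbour s i), i < k]].

Definition is_permutree n (par chi : slots n) : bool :=
  [&& [forall i, (size (par i) == 1) || (size (par i) == 2)],
      [forall i, (size (chi i) == 1) || (size (chi i) == 2)],
      [forall i, forall j, (Some j \in par i) == (Some i \in chi j)],
      (* no multiple edges *)
      [forall i, uniq (pmap id (par i ++ chi i))],
      is_tree (adjacent par chi),
      split_condition (adjacent par chi) par
    & split_condition (adjacent par chi) chi].

Record permutree (n : nat) := Permutree {
  parents : slots n;
  children : slots n;
  permutreeP : is_permutree parents children
}.

Definition decoration_of n (T : permutree n) : {ffun 'I_n -> decoration} :=
  [ffun i => match size (parents T i) == 2, size (children T i) == 2 with
             | false, false => dec_none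
             | false, true => dec_down
             | true, false => dec_up
             | true, true => dec_updown
             end].

Record PT (n : nat) (delta : {ffun 'I_n -> decoration}) := PTree {
  tree_of :> permutree n;
  decoration_tree_of : decoration_of tree_of == delta
}.

Definition subtree n (T : permutree n) (i : 'I_n) (o : option 'I_n) :=
  component (adjacent (parents T) (children T)) i o.

(* Meaningful when v_i has one child; it is then the first entry of the list. *)
Definition descendants n (T : permutree n) (i : 'I_n) : {set 'I_n} :=
  subtree T i (left_neighbour (children T) i).

(* Meaningful when v_i has two children.                                      *)
Definition right_descendants n (T : permutree n) (i : 'I_n) : {set 'I_n} :=
  subtree T i (right_neighbour (children T) i).

Definition cubic_set n (T : permutree n) : {set 'I_n * 'I_n} :=
  [set ij : 'I_n * 'I_n | ij.1 < ij.2 &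
    match decoration_of T ij.1 with
    | dec_none | dec_up => ij.2 \in descendants T ij.1
    | dec_down | dec_updown => ij.2 \in right_descendants T ij.1
    end].

Definition cubic_component n (T : permutree n) (i : 'I_n) : {set 'I_n} :=
  [set j | (i, j) \in cubic_set T].

Definition cubic_vector (R : realType) n (T : permutree n) : 'rV[R]_n.-1 :=
  (\row_(k < n.-1) #|cubic_component T (widen_ord (leq_pred n) k)|%:R)%R.

Definition convex_hull (R : realType) (V : lmodType R) (A : set V) : set V :=
  smallest (@convex_set R V) A.

Definition cubic_polytope (R : realType) n (delta : {ffun 'I_n -> decoration}) :
    set 'rV[R]_n.-1 :=
  convex_hull (range (fun T : PT delta => cubic_vector R T)).

Arguments cubic_polytope R {n} delta.

Lemma cubic_vector_polytope (R : realType) n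
    (delta : {ffun 'I_n -> decoration}) (T : PT delta) :
  cubic_vector R T \in cubic_polytope R delta.
Proof. by apply: mem_set; apply: sub_gen_smallest; exists T. Qed.

Definition cubic_map (R : realType) n (delta : {ffun 'I_n -> decoration})
    (T : PT delta) : cubic_polytope R delta :=
  SigSub (cubic_vector_polytope R T).

(* Main.v *)
Require Import Defs.
From mathcomp Require Import all_boot all_order all_algebra reals.
From mathcomp Require Import zify.

(** For distinct vertices [i], [j] of a permutree let [D i j] say that the path
    from [i] to [j] leaves [i] through a child.  The decoration and [D]
    determine in which component of [T \ v] every vertex lies, hence which
    vertices separate two given ones, hence the edges, hence [T].

    It remains to recover [D] from the cubic vector, which is done by adding
    the vertices in decreasing order.  Adding the smallest vertex [i] amounts
    to subdividing an edge of the tree on the larger vertices.  As [i] may never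
    lie to the right of a vertex with two parents or two children, the
    admissible edges form a directed path, and the set of vertices below an
    edge grows strictly along that path; the entry [c_i] of the cubic vector is
    the cardinal of this set and so singles out the edge. *)

Set Implicit Arguments.
Unset Strict Implicit.
Unset Printing Implicit Defensive.

(** * Trees seen through their direction relation *)

Section DirectionRelation.

Variables (n : nat) (split : 'I_n -> bool -> bool).
Implicit Types (D : rel 'I_n) (i j k m s u v w x : 'I_n).

(* [split v d] tells whether [v] has two children ([d = true]) or two parents
   ([d = false]).  [slot D v u] encodes the component of [T \ v] containing
   [u], and is meaningful for [u != v] only. *)
Definition slot D v u : bool * bool := (D v u, split v (D v u) && (u < v)).

Definition between D v u w : bool :=
  [&& u != v, w != v & slot D v u != slot D v w].

(* In terms of the tree: if [v] separates [u] from [w], then [v] and [w] lie in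
   the same component of [T \ u]; and vertices not separated by any other are
   adjacent, so that one is the parent of the other. *)
Record direction D : Prop := Direction {
  direction_between : forall v u w, between D v u w -> slot D u v = slot D u w;
  direction_adjacent : forall u w, u != w ->
    (forall v, ~~ between D v u w) -> D u w != D w u }.

Lemma betweenC D v u w : between D v u w = between D v w u.
Proof. by rewrite /between andbCA eq_sym [slot _ _ _ == _]eq_sym. Qed.

Lemma between_slot D v u w : between D v u w -> slot D v u != slot D v w.
Proof. by case/and3P. Qed.

Lemma betweenF D v w : between D v v w = false.
Proof. by rewrite /between eqxx. Qed.

(** * Separation and directed paths in a single tree *)

Section Single.

Variables (D : rel 'I_n) (HD : direction D).

Lemma between_slotr v u w : between D v u w -> slot D w v = slot D w u.
Proof. by rewrite betweenC; exact: (direction_between HD). Qed.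

(** Otherwise [x] would separate [v] from [w], so that [x] and [w] would share a component at [v];
    but [x] shares one there with [u], which [v] separates from [w]. *)
Lemma between_trans_slot x u v w :
  between D x u v -> between D v u w -> slot D x v = slot D x w.
Proof.
move=> xuv vuw; have /and3P[ux vx suv] := xuv.
have xw : x != w.
  apply/eqP=> xw; rewrite xw in xuv.
  by move: (between_slot xuv); rewrite (between_slotr vuw) eqxx.
apply/eqP/negPn/negP=> svw.
have xvw : between D x v w by rewrite /between vx eq_sym xw.
have := between_slot vuw.
by rewrite -(between_slotr xuv) (direction_between HD xvw) eqxx.
Qed.

Lemma between_trans x u v w :
  between D x u v -> between D v u w -> between D x u w.
Proof.
move=> xuv vuw; have /and3P[ux vx suv] := xuv.
rewrite /between ux -(between_trans_slot xuv vuw) suv andbT /=.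
apply/eqP=> wx; move: xuv; rewrite -wx => /between_slot.
by rewrite (between_slotr vuw) eqxx.
Qed.

(** The number of separating vertices serves as a distance from [u], for the induction and the
    minimum below. *)
Lemma card_between_lt u v w : between D v u w ->
  #|[set x | between D x u v]| < #|[set x | between D x u w]|.
Proof.
move=> vuw; apply/proper_card/properP; split.
  by apply/subsetP=> x; rewrite !inE => /between_trans; apply.
by exists v; rewrite !inE // betweenC betweenF.
Qed.

(** Cutting at a separating vertex [v] gives two shorter paths of the same kind; their directions
    compose because [v] itself is crossed vertically. *)
Lemma directed_path u w : u != w ->
  (forall v, between D v u w -> D v u != D v w) -> D u w != D w u.
Proof.
have [m] := ubnP #|[set x | between D x u w]|.
elim: m u w => // m IH u w lem uw dir.
case: (pickP (fun v => between D v u w)) => [v vuw|nb]; last first.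
  by apply: (direction_adjacent HD) => // v; rewrite nb.
have vwu := vuw; rewrite betweenC in vwu.
have /and3P[uv wv _] := vuw.
have duv : D u v != D v u.
  apply: IH => //; first exact: leq_trans (card_between_lt vuw) _.
  move=> x xuv; have [-> _] := between_trans_slot xuv vuw.
  exact: dir (between_trans xuv vuw).
have dwv : D w v != D v w.
  apply: IH => //.
    apply: leq_trans (card_between_lt vwu) _.
    by under eq_finset do rewrite betweenC.
  move=> x xwv; have [-> _] := between_trans_slot xwv vwu.
  by rewrite eq_sym; apply: dir; rewrite betweenC; exact: between_trans xwv vwu.
have [euv _] := direction_between HD vuw.
have [ewv _] := direction_between HD vwu.
by move: duv dwv (dir _ vuw); rewrite euv ewv;
  case: (D u w) (D v u) (D w u) (D v w) => [] [] [] [].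
Qed.

(* Every vertex on the path from [i] to [k] smaller than both of them has both
   on its right, so that the path crosses it vertically. *)
Lemma first_larger_vertex (i k : 'I_n) : i < k -> exists m : 'I_n,
  [/\ i < m, m = k \/ between D m i k, D m i = ~~ D i k &
      forall s : 'I_n, i < s -> ~~ between D s i m].
Proof.
move=> ik; pose P (m : 'I_n) := (i < m) && ((m == k) || between D m i k).
have Pk : P k by rewrite /P ik eqxx.
(* [m] is the closest to [i] among the vertices larger than [i] on the path to [k], the end [k]
   included. *)
case: (arg_minnP (fun m : 'I_n => #|[set x | between D x i m]|) Pk).
move=> m /andP[im mk] min_m.
have nsep (s : 'I_n) : i < s -> ~~ between D s i m.
  move=> is_; apply/negP => sim.
  have /min_m : P s.
    rewrite /P is_ /=; apply/orP; right.
    by case/orP: mk => [/eqP <-//|]; exact: between_trans.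
  by rewrite leqNgt card_between_lt.
have dim : D i m != D m i.
  apply: directed_path => [|s sim]; first by rewrite -val_eqE /= neq_ltn im.
  have si : s < i.
    rewrite ltn_neqAle leqNgt (contraTN (@nsep s) sim) andbT.
    by have /and3P[+ _ _] := sim; rewrite -val_eqE eq_sym.
  have := between_slot sim; rewrite /slot.
  have -> : (i < s) = false by rewrite ltnNge ltnW.
  have -> : (m < s) = false by rewrite ltnNge ltnW // (ltn_trans si).
  by rewrite !andbF xpair_eqE eqxx andbT.
exists m; split=> //; first by case/orP: mk => [/eqP|]; [left|right].
have <- : D i m = D i k.
  case/orP: mk => [/eqP->//|mik].
  by have [] := direction_between HD mik.
by move: dim; case: (D i m) (D m i) => [] [].
Qed.

End Single.

(** * Two trees that agree on the vertices larger than [i] *)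

Section Pair.

Variables (D D' : rel 'I_n) (i : 'I_n).
Hypotheses (HD : direction D) (HD' : direction D').
Hypothesis agree : forall u v, i < u -> i < v -> u != v -> D u v = D' u v.

Lemma slot_agree u v : i < u -> i < v -> u != v -> slot D u v = slot D' u v.
Proof. by move=> iu iv uv; rewrite /slot agree. Qed.

Lemma slot_agree_base u : i < u -> D u i = D' u i -> slot D u i = slot D' u i.
Proof. by move=> iu; rewrite /slot => ->. Qed.

Lemma between_agree u v w : i < u -> i < v -> i < w ->
  between D u v w = between D' u v w.
Proof.
move=> iu iv iw; rewrite /between.
have [//|vu] := eqVneq v u; have [//|wu] := eqVneq w u.
by rewrite !slot_agree // eq_sym.
Qed.

Lemma between_agree_base u v : i < u -> i < v -> D u i = D' u i ->
  between D u i v = between D' u i v.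
Proof.
move=> iu iv e; rewrite /between; have [//|vu] := eqVneq v u.
by rewrite slot_agree_base // slot_agree // eq_sym.
Qed.

(* A path from [j] to [k] that starts and ends vertically in the same
   direction turns around at some [s] separating [j] and [k], and [i] would
   have to lie on both sides of [s]. *)
Lemma move_same_direction_aux j k : i < j -> i < k ->
  D j i != D' j i -> D k i != D' k i -> between D j i k -> D j i = D k i.
Proof.
move=> ij ik dj dk jik.
have /and3P[_ kj _] := jik.
have jk : j != k by rewrite eq_sym.
have ski := between_slotr HD jik.
(* For [D], the vertices [i] and [j] lie on the same side of [k]; for [D'] only [i] has left that
   side. *)
have kij : between D' k i j.
  rewrite /between jk -(slot_agree ik ij kj) ski.
  rewrite -[i == k]val_eqE /= neq_ltn ik /=.
  by apply: contra dk => /eqP[-> _].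
have sji := between_slotr HD' kij.
move: ski sji; rewrite -slot_agree // => ski sji.
apply/eqP/negPn/negP => djk.
have ejk : D j k = D k j.
  case: ski sji => -> _ [-> _].
  by move: dj djk; case: (D j i) (D' j i) (D k i) => [] [] [].
case: (pickP (fun s => between D s j k && (D s j == D s k))) => [s|nos].
  case/andP=> sjk /eqP es.
  have [spl ltjk] : split s (D s j) /\ (j < s) != (k < s).
    have := between_slot sjk; rewrite /slot -es xpair_eqE eqxx /=.
    by case: (split _ _).
  have is_ : i < s.
    by case: (ltnP j s) ltjk => [js _|_]; [|case: ltnP => // ks _];
      [exact: ltn_trans js|exact: ltn_trans ks].
  have /and3P[js ks _] := sjk.
  have skj : between D s k j by rewrite betweenC.
  have jki : between D j k i by rewrite betweenC.
  have sjk' : between D' s j k by rewrite -between_agree.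
  have kji : between D' k j i by rewrite betweenC.
  (* At [s], the vertex [i] lies with [j] for [D] and with [k] for [D']. As [i < s] and [s] splits
     on that side, both [j] and [k] would be smaller than [s]. *)
  have [e1 f1] := between_trans_slot HD skj jki.
  have := between_trans_slot HD' sjk' kji.
  rewrite -slot_agree // 1?eq_sym // => -[e2 f2].
  move: f1 f2 ltjk; rewrite -e1 -e2 -es spl is_ /= => -> ->.
  by rewrite eqxx.
have /eqP[] // : D j k != D k j.
by apply: (directed_path HD) => // v vjk; have := nos v; rewrite vjk /= => ->.
Qed.

End Pair.

Section Step.

Variables (D D' : rel 'I_n) (i : 'I_n).
Hypotheses (HD : direction D) (HD' : direction D').
Hypothesis agree : forall u v, i < u -> i < v -> u != v -> D u v = D' u v.

Let agree' u v : i < u -> i < v -> u != v -> D' u v = D u v.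
Proof. by move=> iu iv uv; rewrite agree. Qed.

(** If [j] does not separate [i] from [k] for [D], it does so for [D'], because [i] changes sides at
    [j]; so the auxiliary lemma applies to one of the two trees. *)
Lemma move_same_direction j k : i < j -> i < k ->
  D j i != D' j i -> D k i != D' k i -> D j i = D k i.
Proof.
move=> ij ik dj dk; have [<-//|jk] := eqVneq j k.
have ji : i != j by rewrite -val_eqE /= neq_ltn ij.
have kj : k != j by rewrite eq_sym.
have [jik|] := boolP (between D j i k).
  exact: (move_same_direction_aux HD HD' agree) jik.
rewrite /between ji kj negbK => /eqP sji.
have jik : between D' j i k.
  rewrite /between ji kj -(slot_agree agree ij ik jk) -sji.
  by rewrite xpair_eqE negb_and eq_sym dj.
have := move_same_direction_aux HD' HD agree' ij ik.
rewrite ![D' _ _ == D _ _]eq_sym => /(_ dj dk jik).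
by move: dj dk; case: (D j i) (D' j i) (D k i) (D' k i) => [] [] [] [].
Qed.

(* The edge subdivided by [i] is no lower for [D'] than for [D]. *)
Hypothesis moves_up : forall j, i < j -> D' j i -> D j i.

(** Otherwise the first larger vertices [m] (for [D]) and [m'] (for [D']) towards [k] see [i] in
    opposite directions, hence differ, and each sees [i] alike in both trees. So both lie on both
    paths, and one precedes the other, against the choice of the latter. *)
Lemma moves_up_sub k : i < k -> D i k -> D' i k.
Proof.
move=> ik dik; apply/negPn/negP => d'ik.
have [m [im mk]] := first_larger_vertex HD ik.
rewrite dik => dmi nm.
have [m' [im' mk']] := first_larger_vertex HD' ik.
rewrite d'ik => dmi' nm'.
have emi : D m i = D' m i.
  by move: (@moves_up m im); rewrite dmi; case: (D' m i) => // /(_ isT).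
have emi' : D m' i = D' m' i by rewrite dmi' moves_up.
have mm' : m != m' by apply: contraTneq dmi' => <-; rewrite -emi dmi.
have bm x : i < x -> between D m i x = between D' m i x.
  by move=> ix; exact: between_agree_base.
have bm' x : i < x -> between D m' i x = between D' m' i x.
  by move=> ix; exact: between_agree_base.
have /negP := nm _ im'; rewrite bm' //; apply.
have /negP := nm' _ im; rewrite -bm // => n2.
case: mk => [mk|].
  by rewrite mk in mm' *; case: mk' => // mk'; rewrite mk' eqxx in mm'.
rewrite bm // => mik.
case: mk' => [mk'|mik']; first by rewrite bm // mk' in n2.
apply/negPn/negP => n1; apply: n2; rewrite bm //.
have /and3P[im'_ km' sm'] := mik'.
have /and3P[im_ km sm] := mik.
move: n1; rewrite /between im'_ mm' negbK => /eqP e1.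
have m'mk : between D' m' m k by rewrite /between mm' km' -e1.
by rewrite /between im_ eq_sym mm' (direction_between HD' m'mk).
Qed.

(** A vertex larger than [i] that sees [i] alike in both trees cannot separate [i] from [j]: then
    [j] would see [i] where it sees that vertex, hence alike in both trees. If the conclusion
    failed, the first larger vertex towards [j] would be such a vertex. *)
Lemma moves_up_mem j : i < j -> D j i -> ~~ D' j i -> ~~ D i j && D' i j.
Proof.
move=> ij dj d'j.
have fixed m : i < m -> D m i = D' m i -> between D m i j -> False.
  move=> im emi mij; have mij' := mij.
  rewrite (between_agree_base agree) // in mij'.
  have mj : j != m by have /and3P[] := mij.
  have [+ _] := between_slotr HD mij; have [+ _] := between_slotr HD' mij'.
  by rewrite -agree // (negbTE d'j) => ->; rewrite dj.
apply/andP; split; [apply/negP => dij|apply/negPn/negP => dij].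
  have [m [im mj]] := first_larger_vertex HD ij; rewrite dij => dmi _.
  case: mj => [mj|]; first by rewrite mj dj in dmi.
  apply: fixed => //; apply/eqP; rewrite dmi eq_sym eqbF_neg.
  by apply/negP => /(moves_up im); rewrite dmi.
have [m [im mj]] := first_larger_vertex HD' ij; rewrite dij => dmi _.
case: mj => [mj|]; first by rewrite -mj dmi in d'j.
have emi : D m i = D' m i by rewrite dmi moves_up.
by rewrite -(between_agree_base agree) //; exact: fixed.
Qed.

End Step.

Definition right_below D i : {set 'I_n} :=
  [set j : 'I_n | (i < j) && D i j].

(** The sets below [i] are nested, so equal cardinals make them equal; a vertex passed by [i] would
    belong to only one of them. *)
Lemma moves_up_eq D D' i : direction D -> direction D' ->
  (forall u v, i < u -> i < v -> u != v -> D u v = D' u v) ->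
  (forall j, i < j -> D' j i -> D j i) ->
  #|right_below D i| = #|right_below D' i| ->
  forall j, i < j -> D i j = D' i j /\ D j i = D' j i.
Proof.
move=> HD HD' agree up eqC.
have /eqP eqR : right_below D i == right_below D' i.
  rewrite eqEcard eqC leqnn andbT; apply/subsetP => j; rewrite !inE.
  by case/andP=> ij /(moves_up_sub HD HD' agree up ij); rewrite ij.
move=> j ij; have eij : D i j = D' i j.
  by move/setP/(_ j): eqR; rewrite !inE ij.
split=> //; apply/idP/idP => [dj|]; last exact: up.
apply/negPn/negP => d'j.
by have := moves_up_mem HD HD' agree up ij dj d'j; rewrite eij andNb.
Qed.

(** All changes go the same way, so [moves_up_eq] applies after exchanging [D] and [D'] if
    necessary. *)
Lemma right_below_step D D' i : direction D -> direction D' ->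
  (forall u v, i < u -> i < v -> u != v -> D u v = D' u v) ->
  #|right_below D i| = #|right_below D' i| ->
  forall j, i < j -> D i j = D' i j /\ D j i = D' j i.
Proof.
move=> HD HD' agree eqC.
case: (pickP (fun j => [&& i < j, D' j i & ~~ D j i])) => [j0|noj]; last first.
  apply: moves_up_eq => // j ij d'j.
  by have := noj j; rewrite ij d'j /= => /negbFE.
case/and3P=> ij0 d'j0 dj0 j ij.
have agree' u v : i < u -> i < v -> u != v -> D' u v = D u v.
  by move=> *; rewrite agree.
case: (@moves_up_eq D' D i HD' HD agree' _ (esym eqC) j ij) => // k ik dk.
apply/negPn/negP => d'k.
have := move_same_direction HD HD' agree ij0 ik.
by rewrite (negbTE dj0) d'j0 dk (negbTE d'k) => /(_ isT isT).
Qed.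

Lemma direction_inj D D' : direction D -> direction D' ->
  (forall i, #|right_below D i| = #|right_below D' i|) ->
  forall u v, u != v -> D u v = D' u v.
Proof.
move=> HD HD' eqC.
(* Here [n <= u + d] says that [u] is among the [d] largest vertices. *)
suff main d u v : n <= u + d -> n <= v + d -> u != v -> D u v = D' u v.
  by move=> u v; apply: (main n); rewrite leq_addl.
elim: d u v => [|d IH] u v.
  by rewrite addn0 leqNgt ltn_ord.
rewrite !addnS => nu nv uv.
have step (i j : 'I_n) : n <= (i + d).+1 -> i < j ->
    D i j = D' i j /\ D j i = D' j i.
  move=> ni ij; apply: right_below_step => // x y ix iy xy.
  by apply: IH => //; apply: leq_trans ni _; rewrite -addSn leq_add2r.
have [uv'|vu|/val_inj uv'] := ltngtP u v.
- by have [] := step _ _ nu uv'.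
- by have [] := step _ _ nv vu.
- by rewrite uv' eqxx in uv.
Qed.

End DirectionRelation.

(** * Separation in finite trees *)

Section Tree.

Variables (n : nat) (e : rel 'I_n) (tree : is_tree e).
Implicit Types (u v w x y : 'I_n) (p : seq 'I_n).

Let e_sym x y : e x y = e y x.
Proof. by case/and4P: tree => _ /forallP/(_ x)/forallP/(_ y)/eqP. Qed.

Lemma component_last v x p :
  path e x p -> v \notin x :: p -> last x p \in component e v (Some x).
Proof.
move=> ep nv; rewrite inE; apply/connectP; exists p => //.
apply: (sub_in_path (P := predC1 v)) ep => [a b|].
  by rewrite !inE => -> -> ->.
by apply/allP => y /=; apply: contraTneq => ->.
Qed.

Lemma component_path v x u : x != v -> u \in component e v (Some x) ->
  exists p, [/\ path e x p, v \notin x :: p, uniq (x :: p) & last x p = u].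
Proof.
move=> xv; rewrite inE => /connectP[p + ->].
case/shortenP=> q eq uq _; exists q; split=> //.
  by apply: sub_path eq => a b /and3P[].
elim: q x xv eq {uq} => [|y q IH] x xv /=; first by rewrite inE eq_sym.
case/andP=> /and3P[_ _ yv] /(IH _ yv).
by rewrite !inE !negb_or [v == x]eq_sym xv.
Qed.

Lemma tree_no_ucycle (s : seq 'I_n) : 2 < size s -> ~~ ucycleb e s.
Proof.
move=> s2; apply/negP => cs.
have lts : size s < #|'I_n|.+1.
  by rewrite ltnS -(card_uniqP _) ?max_card //; case/andP: cs.
case/and4P: tree => _ _ _ /forallP/(_ (Ordinal lts))/forallP/(_ (in_tuple s)).
by rewrite /= s2 cs.
Qed.

(** Two distinct neighbours of [v] joined by a path avoiding [v] would close up to a cycle. *)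
Lemma component_inj v x y u : e v x -> e v y ->
  u \in component e v (Some x) -> u \in component e v (Some y) -> x = y.
Proof.
move=> vx vy ux uy.
have neq z : e v z -> z != v.
  apply: contraTneq => ->.
  by case/and4P: tree => /forallP/(_ v).
have : y \in component e v (Some x).
  move: ux uy; rewrite !inE => ux uy; apply: connect_trans ux _.
  rewrite (sym_connect_sym (e := fun a b => [&& e a b, a != v & b != v])) //.
  by move=> a b; rewrite e_sym [(a != v) && _]andbC.
case/(component_path (neq _ vx))=> p [ep nv up py].
apply/eqP/negPn/negP => xy.
have /negP[] : ~~ ucycleb e (v :: x :: p).
  by apply: tree_no_ucycle; case: p py {ep nv up} xy => //= ->; rewrite eqxx.
by rewrite /ucycleb /= vx rcons_path ep py e_sym vy nv.
Qed.

Lemma simple_path u w : u != w ->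
  exists x p, [/\ e u x, path e x p, uniq [:: u, x & p] & last x p = w].
Proof.
case/and4P: tree => _ _ /forallP/(_ u)/forallP/(_ w)/connectP[p + ->] _.
case/shortenP=> -[|x q] /=; first by rewrite eqxx.
by case/andP=> ux eq uq _ _; exists x, q.
Qed.

(** Names the component containing [u] by its unique neighbour of [v]; in a tree the default is
    taken only for [u = v]. *)
Definition towards v u : 'I_n :=
  odflt v [pick x | e v x && (u \in component e v (Some x))].

Lemma towards_eq v x u :
  e v x -> u \in component e v (Some x) -> towards v u = x.
Proof.
move=> vx ux; rewrite /towards; case: pickP => [y /andP[vy uy]|/(_ x)] /=.
  exact: component_inj vy vx uy ux.
by rewrite vx ux.
Qed.

Lemma towards_simple v x p : e v x -> path e x p -> v \notin x :: p ->
  towards v (last x p) = x.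
Proof. by move=> vx ep nv; apply: towards_eq => //; exact: component_last. Qed.

Lemma towards_adj v x : e v x -> towards v x = x.
Proof. by move=> vx; apply: towards_eq; rewrite // inE connect0. Qed.

Lemma towardsP v u : u != v ->
  e v (towards v u) /\ u \in component e v (Some (towards v u)).
Proof.
rewrite eq_sym => /simple_path[x [p [vx ep /andP[nv _] <-]]].
by rewrite towards_simple //; split=> //; exact: component_last.
Qed.

Lemma towards_path v x p : path e x p -> v \notin x :: p ->
  towards v (last x p) = towards v x.
Proof.
move=> ep nv; have xv : x != v by apply: contraNneq nv => ->; exact: mem_head.
have [vt xt] := towardsP xv.
apply: towards_eq => //; have := component_last ep nv.
by move: xt; rewrite !inE; exact: connect_trans.
Qed.

(** If [u] were on the simple path from [v] to [w], then [v] would reach [u] and [w] through the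
    same neighbour. So that path avoids [u] and keeps [v] and [w] on one side of it. *)
Lemma towards_between v u w : u != v -> w != v ->
  towards v u != towards v w -> towards u v = towards u w.
Proof.
move=> uv; rewrite eq_sym => /simple_path[x [p [vx ep /andP[nv _] <-]]].
rewrite towards_simple // => tx.
have [uxp|nu] := boolP (u \in x :: p); last first.
  rewrite (@towards_path u v (x :: p)) //=; first by rewrite vx.
  by rewrite inE negb_or uv.
case/splitPl: uxp ep nv => p1 p2 lu; rewrite cat_path => /andP[ep1 _].
rewrite -cat_cons mem_cat negb_or => /andP[nv1 _].
by rewrite -lu towards_simple // eqxx in tx.
Qed.

Lemma towards_edge u w : u != w ->
  e u w = [forall v, (u != v) && (w != v) ==> (towards v u == towards v w)].
Proof.
move=> uw; apply/idP/forallP => [euw v|no].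
  apply/implyP => /andP[uv wv]; rewrite eq_sym.
  rewrite (@towards_path v u [:: w]) //= ?euw //.
  by rewrite !inE !negb_or ![v == _]eq_sym uv wv.
(* A path with inner vertices would have its first one, [x], separate [u] from [w]. *)
have [x [[|y p] [ux ep up lw]]] := simple_path uw; first by rewrite -lw.
case/and3P: up => /norP[ux' uyp] xyp _.
have xw : w != x.
  by apply: contraNneq xyp => <-; rewrite -lw /= mem_last.
have /implyP := no x; rewrite ux' xw => /(_ isT).
case/andP: ep => xy ep.
rewrite towards_adj 1?e_sym // -lw /= (towards_simple xy) // => /eqP uy.
by rewrite uy /= eqxx in uyp.
Qed.

End Tree.

(** * Permutrees *)

Section Permutree.

Variables (n : nat) (T : permutree n).
Implicit Types (u v w i j : 'I_n) (d : bool).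

Let e := adjacent (parents T) (children T).

Definition ports d i : seq (option 'I_n) :=
  if d then children T i else parents T i.

Definition goes_down i j : bool :=
  Some (towards e i j) \in children T i.

Definition splits i d : bool := size (ports d i) == 2.

Lemma permutree_tree : is_tree e.
Proof. by case: T @e => par chi /= /and5P[_ _ _ _ /and3P[]]. Qed.

Lemma size_ports d i : (size (ports d i) == 1) || splits i d.
Proof.
rewrite /splits /ports; case: T => par chi /= /and3P[/forallP Hp /forallP Hc _].
by case: d.
Qed.

Lemma parent_child i j : (Some j \in parents T i) = (Some i \in children T j).
Proof.
by case: T => par chi /= /and3P[_ _ /andP[/forallP/(_ i)/forallP/(_ j)/eqP]].
Qed.

Lemma not_parent_child i j :
  Some j \in parents T i -> Some j \notin children T i.
Proof.
case: T => par chi /= /and5P[_ _ _ /forallP/(_ i) + _].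
rewrite pmap_cat cat_uniq => /and3P[_ /hasPn npc _] jp; apply/negP => jc.
have mem (s : seq (option 'I_n)) : Some j \in s -> j \in pmap id s.
  by rewrite mem_pmap map_id.
by have /negP := npc _ (mem _ jc); apply; exact: mem.
Qed.

Lemma ports_order d i : splits i d ->
  (forall j, j \in component e i (nth None (ports d i) 0) -> j < i) /\
  (forall j, j \in component e i (nth None (ports d i) 1) -> i < j).
Proof.
rewrite /splits /ports /e.
case: T => par chi /= /and5P[_ _ _ _ /and3P[_]].
move=> /forallP/(_ i) Hp /forallP/(_ i) Hc.
case: d => s2; [move: Hc | move: Hp];
by rewrite s2 /= => /andP[/forall_inP ? /forall_inP ?].
Qed.

Lemma towards_port i j : j != i ->
  Some (towards e i j) \in ports (goes_down i j) i.
Proof.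
move=> ji; have [/orP + _] := towardsP permutree_tree ji.
by rewrite /goes_down /ports; case: ifP => // nc [].
Qed.

Lemma port_adjacent d i x : Some x \in ports d i -> e i x.
Proof. by rewrite /e /adjacent; case: d => /= ->; rewrite ?orbT. Qed.

Lemma lt_left_port i j : j != i -> splits i (goes_down i j) ->
  (j < i) = (Some (towards e i j) == nth None (ports (goes_down i j) i) 0).
Proof.
move=> ji sp; have [Hl Hr] := ports_order sp.
have [_ jt] := towardsP permutree_tree ji.
have := towards_port ji; move: sp Hl Hr; rewrite /splits.
case: (ports _ _) => [|l [|r [|]]] //= _ Hl Hr; rewrite !inE.
have [le _|_ /= /eqP re] := eqVneq; first by rewrite Hl -?le.
by apply/negbTE; rewrite -leqNgt ltnW // Hr -?re.
Qed.

(** The direction selects the parents or the children of [v], and when there are two of them the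
    comparison with [v] tells left from right. *)
Lemma slot_towards v u w : u != v -> w != v ->
  (slot splits goes_down v u == slot splits goes_down v w) =
  (towards e v u == towards e v w).
Proof.
move=> uv wv; rewrite xpair_eqE; apply/andP/eqP => [[/eqP duw]|tuw]; last first.
  have duw : goes_down v u = goes_down v w by rewrite /goes_down tuw.
  rewrite duw; split=> //; have [sp|//] := boolP (splits _ _).
  by rewrite !lt_left_port ?duw // tuw.
have [sp|nsp] := boolP (splits v (goes_down v u)).
  rewrite -duw sp /= !lt_left_port -?duw //.
  have := towards_port uv; have := towards_port wv; rewrite -duw.
  move: sp; rewrite /splits; case: (ports _ _) => [|l [|r [|]]] //= _.
  rewrite !inE.
  have [<-|_] := eqVneq (Some (towards e v u)) l.
    by case: eqVneq => // -[].
  by case: eqVneq => //= _ /eqP<- /eqP[].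
move=> _; have := size_ports (goes_down v u) v; rewrite (negbTE nsp) orbF.
have := towards_port uv; have := towards_port wv; rewrite -duw.
by case: (ports _ _) => [|l []] //=; rewrite !inE => /eqP<- /eqP[].
Qed.

Lemma between_towards v u w : between splits goes_down v u w =
  [&& u != v, w != v & towards e v u != towards e v w].
Proof.
rewrite /between; have [//|uv] := eqVneq u v; have [//|wv] := eqVneq w v.
by rewrite slot_towards.
Qed.

Lemma adjacentE u w : e u w =
  (u != w) && [forall v, ~~ between splits goes_down v u w].
Proof.
have [<-|uw] /= := eqVneq u w.
  by case/and4P: permutree_tree => /forallP/(_ u)/negbTE.
rewrite (towards_edge permutree_tree uw); apply: eq_forallb => v.
by rewrite between_towards; case: (u != v) (w != v) => [] []; rewrite //= negbK.
Qed.

Lemma childE i j : (Some j \in children T i) = e i j && goes_down i j.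
Proof.
have [eij|neij] := boolP (e i j).
  by rewrite /goes_down (towards_adj permutree_tree eij).
by apply/negbTE; apply: contra neij; exact: (@port_adjacent true).
Qed.

Lemma parentE i j : (Some j \in parents T i) = e i j && ~~ goes_down i j.
Proof.
have [eij|neij] := boolP (e i j); last first.
  by apply/negbTE; apply: contra neij; exact: (@port_adjacent false).
rewrite /goes_down (towards_adj permutree_tree eij) /=.
apply/idP/idP; first exact: not_parent_child.
by case/orP: eij => // ->.
Qed.

Lemma permutree_direction : direction splits goes_down.
Proof.
split=> [v u w|u w uw nob].
  rewrite between_towards => /and3P[uv wv t]; apply/eqP.
  have wu : w != u by apply: contraNneq t => ->.
  have vu : v != u by rewrite eq_sym.
  by rewrite slot_towards // (towards_between permutree_tree uv wv t).
have euw : e u w by rewrite adjacentE uw; apply/forallP.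
have ewu : e w u.
  by rewrite /e /adjacent orbC -(parent_child u w) (parent_child w u).
rewrite /goes_down !(towards_adj permutree_tree) // -(parent_child u w).
have [jp|njp] := boolP (Some w \in parents T u).
  by rewrite (negbTE (not_parent_child jp)).
by case/orP: euw njp => [->|->].
Qed.

Lemma cubic_component_right_below i :
  cubic_component T i = right_below goes_down i.
Proof.
apply/setP => j; rewrite !inE /=; have [ij|//] /= := ltnP i j.
have ji : j != i by rewrite -val_eqE /= neq_ltn ij orbT.
have [et jt] := towardsP permutree_tree ji.
rewrite ffunE /descendants /right_descendants /subtree -/e.
rewrite /left_neighbour /right_neighbour.
(* The boolean [splits i true] is coerced to an index: 0 for an only child, 1 for the right one of
   two. *)
have -> : (match (match size (parents T i) == 2, size (children T i) == 2 with
    | false, false => dec_none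
    | false, true => dec_down
    | true, false => dec_up
    | true, true => dec_updown
    end) with
  | dec_none | dec_up => j \in component e i (nth None (children T i) 0)
  | _ => j \in component e i (nth None (children T i) 1)
  end) = (j \in component e i (nth None (children T i) (splits i true))).
  by rewrite /splits /=; do 2!case: (size _ == 2).
have mem_comp k : k < size (children T i) ->
    j \in component e i (nth None (children T i) k) -> goes_down i j.
  move=> lk; rewrite /goes_down; have := mem_nth None lk.
  case: (nth _ _ _) => [x xc jx|]; last by rewrite inE.
  by rewrite (towards_eq permutree_tree _ jx) // (@port_adjacent true).
have sz := size_ports true i.
apply/idP/idP.
  apply: mem_comp; move: sz; rewrite /splits /=.
  by case: (size _) => [|[|[|]]].
move=> dij; have := towards_port ji; rewrite dij.
case: (boolP (splits i true)) => [sp|nsp].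
  (* Being larger than [i], the vertex [j] cannot lie in the left descendant subtree. *)
  have [Hl _] := ports_order sp; move: sp Hl; rewrite /splits /=.
  case: (children T i) => [|l [|r [|]]] //= _ Hl; rewrite !inE.
  case: eqVneq => [le _|_ /= /eqP<- //].
  by have := Hl j; rewrite -le => /(_ jt); rewrite ltnNge ltnW.
move: sz; rewrite (negbTE nsp) orbF /=.
by case: (children T i) => [|l []] //= _; rewrite inE => /eqP<-.
Qed.

End Permutree.

(** * Recovering the permutree from its decoration and directions *)

(** With two ports, the split condition forces a vertex smaller than [i] to the left and a larger
    one to the right; the remaining places are leaves. *)
Lemma ports_eq n (T T' : permutree n) d i :
  splits T i d = splits T' i d ->
  (forall x, (Some x \in ports T d i) = (Some x \in ports T' d i)) ->
  ports T d i = ports T' d i.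
Proof.
move=> esp emem.
have sz := size_ports T d i; have sz' := size_ports T' d i.
have [sp|nsp] := boolP (splits T i d); last first.
  move: sz sz' emem; rewrite -esp (negbTE nsp) !orbF.
  case: (ports T d i) => [|o []] //.
  case: (ports T' d i) => [|o' []] // _ _ emem.
  case: o o' emem => [x|] [y|] // emem.
  - by have := emem x; rewrite !inE eqxx => /esym/eqP->.
  - by have := emem x; rewrite !inE eqxx.
  - by have := emem y; rewrite !inE eqxx.
have sp' : splits T' i d by rewrite -esp.
have [Hl Hr] := ports_order sp; have [Hl' Hr'] := ports_order sp'.
have self (S : permutree n) x :
  x \in component (adjacent (parents S) (children S)) i (Some x).
  by rewrite inE connect0.
move: sp sp' Hl Hr Hl' Hr' emem; rewrite /splits.
case: (ports T d i) => [|l [|r [|]]] //.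
case: (ports T' d i) => [|l' [|r' [|]]] //= _ _.
move=> Hl Hr Hl' Hr' emem.
have no x : x < i -> i < x -> False by move=> xi /(ltn_trans xi); rewrite ltnn.
have le x : (Some x == l) = (Some x == l').
  apply/eqP/eqP => E; have := emem x; rewrite !inE E eqxx ?orbT.
    move=> /esym/orP[/eqP//|/eqP E']; case: (no x).
      by apply: Hl; rewrite -E self.
    by apply: Hr'; rewrite -E' -E self.
  move=> /orP[/eqP//|/eqP E']; case: (no x).
    by apply: Hl'; rewrite -E self.
  by apply: Hr; rewrite -E' -E self.
have re x : (Some x == r) = (Some x == r').
  apply/eqP/eqP => E; have := emem x; rewrite !inE E eqxx ?orbT.
    move=> /esym/orP[/eqP E'|/eqP//]; case: (no x); last first.
      by apply: Hr; rewrite -E self.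
    by apply: Hl'; rewrite -E' -E self.
  move=> /orP[/eqP E'|/eqP//]; case: (no x); last first.
    by apply: Hr'; rewrite -E self.
  by apply: Hl; rewrite -E' -E self.
have opt (o o' : option 'I_n) :
    (forall x, (Some x == o) = (Some x == o')) -> o = o'.
  case: o o' => [x|] [y|] // E.
  - by have := E x; rewrite eqxx => /esym/eqP.
  - by have := E x; rewrite eqxx.
  - by have := E y; rewrite eqxx.
by rewrite (opt _ _ le) (opt _ _ re).
Qed.

Lemma decoration_splits n (T T' : permutree n) :
  decoration_of T = decoration_of T' -> splits T =2 splits T'.
Proof.
move=> /ffunP eqT i d; have := eqT i; rewrite !ffunE /splits.
by case: d => /=; do 4!case: (size _ == 2).
Qed.

Lemma eq_between n (sp sp' : 'I_n -> bool -> bool) (D D' : rel 'I_n) v u w :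
  sp =2 sp' -> (forall x y, x != y -> D x y = D' x y) ->
  between sp D v u w = between sp' D' v u w.
Proof.
move=> esp eD; rewrite /between /slot.
have [//|uv] := eqVneq u v; have [//|wv] := eqVneq w v.
by rewrite !esp !eD // eq_sym.
Qed.

Lemma permutree_eq n (T T' : permutree n) :
  parents T = parents T' -> children T = children T' -> T = T'.
Proof.
case: T T' => par chi H [par' chi' H'] /= ep ec; subst par' chi'.
by congr Permutree; exact: bool_irrelevance.
Qed.

Lemma cubic_component_card_inj n (T T' : permutree n) :
  decoration_of T = decoration_of T' ->
  (forall i, #|cubic_component T i| = #|cubic_component T' i|) -> T = T'.
Proof.
move=> /decoration_splits esp ecard.
(* [direction_inj] compares two directions over one and the same splitting function. *)
have HT' : direction (splits T) (goes_down T').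
  have [H1 H2] := permutree_direction T'.
  split=> [v u w|u w uw nob].
    rewrite (eq_between v u w esp (D' := goes_down T')) // => /H1.
    by rewrite /slot !esp.
  by apply: H2 => // v; rewrite -(eq_between v u w esp (D := goes_down T')).
have eD u v : u != v -> goes_down T u v = goes_down T' u v.
  apply: (direction_inj (permutree_direction T) HT') => i.
  by rewrite -!cubic_component_right_below.
have eadj u v : adjacent (parents T) (children T) u v =
    adjacent (parents T') (children T') u v.
  rewrite !adjacentE; congr (_ && _); apply: eq_forallb => x.
  by rewrite (eq_between x u v esp eD).
have eports d i : ports T d i = ports T' d i.
  apply: ports_eq => // x; case: d => /=; rewrite ?childE ?parentE eadj;
  by rewrite adjacentE; have [//|ix] := eqVneq i x; rewrite eD.
apply: permutree_eq; apply/ffunP => i.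
  exact: (eports false).
exact: (eports true).
Qed.

Theorem theorem3p9 (R : realType) (n : nat)
    (delta : {ffun 'I_n -> decoration}) :
  injective (@cubic_map R n delta).
Proof.
move=> [T dT] [T' dT'] /(congr1 val) /= /rowP ecv.
have eT : T = T'.
  apply: cubic_component_card_inj => [|i].
    by rewrite (eqP dT) (eqP dT').
  have [lti|gei] := ltnP i n.-1.
    have := ecv (Ordinal lti); rewrite !mxE => /eqP.
    rewrite Num.Theory.eqr_nat => /eqP.
    by rewrite (_ : widen_ord _ _ = i) //; exact: val_inj.
  (* The vector has no entry for the last vertex, but no vertex is larger than that one. *)
  have empty S : cubic_component S i = finset.set0.
    apply/setP => j; rewrite !inE /=; case: ltnP => // ij.
    by have := ltn_ord j; lia.
  by rewrite !empty.
by subst T'; congr PTree; exact: bool_irrelevance.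
Qed.
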